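(* Let $p,k$ be integers with $k\ge 2$ and $p\ge 2k$, and let $G=KG_{p,k}$ be the Kneser graph, with $n$ vertices and $m$ edges. Let $\mu_1\ge\cdots\ge\mu_n$ be the eigenvalues of the adjacency matrix of $G$, let $n^+$ be the number of positive eigenvalues, let $\omega=\omega(G)$ be the clique number of $G$, and let $\ell=\min(n^+,\omega)$. Then \[ \mu_1^2+\mu_2^2+\cdots+\mu_\ell^2\le \frac{2m(\omega-1)}{\omega}. \]
   Context: The Kneser graph $KG_{p,k}$ has as vertices the $k$-element subsets of a $p$-element set, two vertices being adjacent if and only if the corresponding subsets are disjoint. Eigenvalues are those of the adjacency matrix. *)

(* Defs.v *)
From HB Require Import structures.
From mathcomp Require Import all_boot all_order all_algebra.
From mathcomp Require Import reals.
Set Implicit Arguments. Unset Strict Implicit. Unset Printing Implicit Defensive.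
Import Order.TTheory GRing.Theory Num.Theory.

Definition kvert (p k : nat) := {S : {set 'I_p} | #|S| == k}.

Definition kadj (p k : nat) (u v : kvert p k) : bool :=
  [disjoint val u & val v].

Definition knum (p k : nat) : nat := #|{: kvert p k}|.

Definition kedges (p k : nat) : {set {set kvert p k}} :=
  [set E : {set kvert p k} |
     [exists u, exists v, (E == [set u; v]) && kadj u v]].

Definition knedges (p k : nat) : nat := #|kedges p k|.

Definition kclique (p k : nat) (Q : {set kvert p k}) : bool :=
  [forall u in Q, forall v in Q, (u != v) ==> kadj u v].

Definition kclique_number (p k : nat) : nat :=
  \max_(Q : {set kvert p k} | kclique Q) #|Q|.

Definition kadjmx (R : nzRingType) (p k : nat) : 'M[R]_(knum p k) :=
  \matrix_(i, j) ((kadj (enum_val i) (enum_val j))%:R)%R.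

(* Main.v *)
Require Import Defs.
From HB Require Import structures.
From mathcomp Require Import all_boot all_order all_algebra.
From mathcomp Require Import reals.
From mathcomp Require Import ring lra zify.
Set Implicit Arguments. Unset Strict Implicit. Unset Printing Implicit Defensive.
Import Order.TTheory GRing.Theory Num.Theory.

(** Write n = C(p,k), d = C(p-k,k) and c = C(p-k-1,k-1), so that G is
d-regular on n vertices, 2m = nd = tr A^2 is the sum of all the mu_i^2, and
(p-k)c = kd. Two estimates of the left-hand side S suffice, and most of the
spectrum of G is not needed. First, |mu_i| <= d gives S <= omega d^2. Second, the
incidence matrix M of points versus k-sets has rank p and M(A + c) is
constant, so -c is an eigenvalue of multiplicity at least p-1; as S only
involves positive eigenvalues, S <= nd - (p-1)c^2. Since omega = floor(p/k),
the first estimate is good enough when n/d >= omega^2/(omega-1), the second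
when n/d <= omega (p-1) k^2/(p-k)^2. For k > omega one of these always holds
because the second threshold exceeds the first; for k <= omega the second holds
because n <= kd for k >= 5, and by direct computation for k = 2, 3, 4
(only p = 4 needs the first estimate). *)

(** * Binomial inequalities *)

(** Bernoulli's inequality (1 - k/a)^j >= 1 - jk/a with denominators cleared. *)
Lemma bernoulli_nat (a k j : nat) :
  (j * k <= a)%N -> (a ^ j * (a - j * k) <= (a - k) ^ j * a)%N.
Proof.
elim: j => [|j IH] h; first by rewrite !expn0 !mul1n leq_subr.
have {}IH := IH ltac:(nia).
have hk : (k <= a)%N by nia.
move: IH h; rewrite !expnS.
move: (a ^ j)%N ((a - k) ^ j)%N => x y IH h.
have e1 : (a * x * (a - j.+1 * k) <= (a - k) * (x * (a - j * k)))%N.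
  rewrite [(_ * (x * _))%N]mulnCA -mulnA [(a * (x * _))%N]mulnCA leq_mul2l; apply/orP; right.
  have [b ->] : exists b, a = (b + j.+1 * k)%N by exists (a - j.+1 * k)%N; lia.
  have -> : (b + j.+1 * k - j.+1 * k = b)%N by lia.
  have -> : (b + j.+1 * k - k = b + j * k)%N by nia.
  have -> : (b + j.+1 * k - j * k = b + k)%N by nia.
  nia.
apply: leq_trans e1 _.
by rewrite -mulnA leq_mul2l IH orbT.
Qed.

(** Used with k = 2j and a = p-k+1, where the hypothesis becomes k^2 <= p. Since a may be smaller
    than k^2, Bernoulli is applied with exponent k/2 and then squared, which leaves a^2 <=
    k(a-jk)^2. *)
Lemma expn_le_mul_even (a j : nat) : (3 <= j)%N -> ((j.*2) ^ 2 + 1 <= a + j.*2)%N ->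
  (a ^ j.*2 <= j.*2 * (a - j.*2) ^ j.*2)%N.
Proof.
move=> hj ha.
have hb := @bernoulli_nat a j.*2 j ltac:(nia).
have hq : (a ^ 2 <= j.*2 * (a - j * j.*2) ^ 2)%N.
  (* The ratio 12/5 is admissible from j = 3 on, and its square is below 6 <= 2j. *)
  have h1 : (5 * a <= 12 * (a - j * j.*2))%N by nia.
  have : ((5 * a) ^ 2 <= (12 * (a - j * j.*2)) ^ 2)%N by rewrite leq_exp2r.
  rewrite !expnMn; nia.
rewrite -(@leq_pmul2r (a ^ 2)) ?expn_gt0; last by apply/orP; left; nia.
apply: leq_trans (_ : a ^ j.*2 * (j.*2 * (a - j * j.*2) ^ 2) <= _)%N.
  by rewrite leq_mul2l hq orbT.
rewrite mulnCA -mulnA leq_mul2l; apply/orP; right.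
rewrite -[X in (_ ^ X)%N]addnn -[X in (_ <= _ ^ X * _)%N]addnn !expnD.
by have := leq_mul hb hb; rewrite mulnACA [leqRHS]mulnACA !mulnn.
Qed.

(** Two copies of Bernoulli with exponent j and one exact factor a-k leave a^3 <= k(a-k)(a-jk)^2,
    where k = 2j+1. *)
Lemma expn_le_mul_odd (a j : nat) : (2 <= j)%N -> ((j.*2.+1) ^ 2 + 1 <= a + j.*2.+1)%N ->
  (a ^ j.*2.+1 <= j.*2.+1 * (a - j.*2.+1) ^ j.*2.+1)%N.
Proof.
move=> hj ha; set k := j.*2.+1.
have hb := @bernoulli_nat a k j ltac:(nia).
have hq : (a ^ 3 <= k * (a - k) * (a - j * k) ^ 2)%N.
  (* For k = 5 the bound [h2] below fails at the least admissible value a = 21, so this case is done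
     directly. *)
  have [hj2|hj3] := leqP j 2.
    have -> : k = 5 by rewrite /k; lia.
    have -> : j = 2 by lia.
    have [x ->] : exists x, a = (x + 21)%N by exists (a - 21)%N; rewrite /k in ha; nia.
    have -> : (x + 21 - 5 = x + 16)%N by lia.
    have -> : (x + 21 - 2 * 5 = x + 11)%N by lia.
    nia.
  have h1 : (a <= 2 * (a - j * k))%N by rewrite /k in ha *; nia.
  have h2 : (4 * a <= k * (a - k))%N by rewrite /k in ha *; nia.
  have h3 : (a * a <= (2 * (a - j * k)) * (2 * (a - j * k)))%N by rewrite leq_mul.
  by have := leq_mul h2 h3; rewrite !expnS expn0; lia.
have a0 : (0 < a)%N by nia.
rewrite -(@leq_pmul2r (a ^ 2)) ?expn_gt0 ?a0 //.
have E : (a ^ k = a * (a ^ j * a ^ j))%N by rewrite expnS -addnn expnD.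
have E' : ((a - k) ^ k = (a - k) * ((a - k) ^ j * (a - k) ^ j))%N by rewrite expnS -addnn expnD.
rewrite E E'.
have h1 := leq_mul hb hb; rewrite mulnACA [leqRHS]mulnACA !mulnn in h1.
apply: leq_trans (_ : (k * (a - k)) * ((a ^ j * a ^ j) * (a - j * k) ^ 2) <= _)%N; last first.
  rewrite !mulnn.
  rewrite [leqRHS](_ : _ = k * (a - k) * (((a - k) ^ j) ^ 2 * a ^ 2))%N; last by ring.
  by rewrite leq_mul2l h1 orbT.
rewrite [leqLHS](_ : _ = a ^ j * a ^ j * a ^ 3)%N; last by rewrite !expnS expn0; ring.
by rewrite mulnCA leq_mul2l hq orbT.
Qed.

(** The quotient of the falling factorials is a product of factors (m-s)/(m-k-s) with s < i. They
    increase with s, so s <= k-1 bounds each by (m-k+1)/(m-2k+1). *)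
Lemma ffact_ratio (k m i : nat) : (i <= k)%N ->
  (2 * k <= m)%N ->
  (m ^_ i * (m - 2 * k + 1) ^ i <= (m - k) ^_ i * (m - k + 1) ^ i)%N.
Proof.
elim: i => [|i IH] hi hm; first by rewrite !ffactn0 !expn0.
have {}IH := IH ltac:(lia) hm.
rewrite !ffactnSr !expnSr.
have h : ((m - i) * (m - 2 * k + 1) <= (m - k - i) * (m - k + 1))%N.
  have [x ->] : exists x, m = (2 * k + x)%N by exists (m - 2 * k)%N; lia.
  have [y ->] : exists y, k = (i + y.+1)%N by exists (k - i.+1)%N; lia.
  have -> : (2 * (i + y.+1) + x - i = i + y.+1.*2 + x)%N by lia.
  have -> : (2 * (i + y.+1) + x - 2 * (i + y.+1) = x)%N by lia.
  have -> : (2 * (i + y.+1) + x - (i + y.+1) = i + y.+1 + x)%N by lia.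
  have -> : (i + y.+1 + x - i = y.+1 + x)%N by lia.
  nia.
by rewrite mulnACA [leqRHS]mulnACA leq_mul.
Qed.

(** The comparison of the two thresholds for n/d: t^2/(t-1) <= t(p-1)k^2/(p-k)^2. *)
Lemma omega_lt_k_bound (p k t : nat) : (2 <= t)%N -> (t < k)%N -> (t * k <= p)%N -> (p < t.+1 * k)%N ->
  (t * (p - k) ^ 2 <= t.-1 * k ^ 2 * p.-1)%N.
Proof.

move=> ht hk h1 h2.
have [s hs] : exists s, p = (t * k + s)%N by exists (p - t * k)%N; lia.
have [w hw] : exists w, t = w.+1 by exists t.-1; lia.
have w0 : (0 < w)%N by lia.
have hsk : (s <= k)%N by nia.
have hkw : (w + 2 <= k)%N by lia.
have -> : (p - k = w * k + s)%N by nia.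
have -> : (p.-1 = t * k - 1 + s)%N by nia.
(* After s^2 <= sk, the left side has sk with coefficient 2w^2+3w+1. The part w(w+2) is absorbed by
   the term wk^2s on the right ([e2]); the rest, w^2+w+1, is moved to the terms free of s by s <= k
   ([e3]). *)
have e1 : (s * s <= s * k)%N by rewrite leq_mul2l hsk orbT.
have e2 : (s * (k * (w * (w + 2))) <= s * (k * (w * k)))%N.
  by rewrite !leq_mul2l hkw !orbT.
have e3 : (s * (k * (w * w + w + 1)) <= k * (k * (w * w + w + 1)))%N.
  by rewrite leq_mul2r hsk orbT.
have e4 : (t * (w * w) + (w * w + w + 1) <= w * (t * k - 1))%N.
  have : (t * (w + 2) <= t * k)%N by rewrite leq_mul2l hkw orbT.
  rewrite hw => h; have {}h : (w * w + 3 * w + 1 <= w.+1 * k - 1)%N by lia.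
  by apply: leq_trans (leq_mul (leqnn w) h); lia.
have e5 : (k * k * (t * (w * w) + (w * w + w + 1)) <= k * k * (w * (t * k - 1)))%N.
  by rewrite leq_mul2l e4 orbT.
have e6 : (t * (s * s) <= t * (s * k))%N by rewrite leq_mul2l e1 orbT.
move: (t * k - 1)%N e5 => z e5; rewrite hw /= in e5 e6 *; rewrite !expnS !expn0; lia.
Qed.

(** The factor p-(k-1) stands in for omega k, which it bounds from below without a floor.
    Multiplying by k! turns the binomials into falling factorials. *)
Lemma bin_ratio_small_k (p k : nat) : (2 <= k)%N -> (4 < p)%N -> (k * k <= p)%N ->
  ('C(p, k) * (p - k) ^ 2 <= (p - k.-1) * p.-1 * k * 'C(p - k, k))%N.
Proof.
move=> h2 p4 hp.
rewrite -(@leq_pmul2r k`!) ?fact_gt0 // [leqLHS]mulnAC bin_ffact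
  -[leqRHS]mulnA bin_ffact.
have [k5|k5] := leqP 5 k.
  have h : (p ^_ k <= k * (p - k) ^_ k)%N.
    have h := @ffact_ratio k p k (leqnn k) ltac:(nia).
    have hk : ((p - k + 1) ^ k <= k * (p - 2 * k + 1) ^ k)%N.
      have -> : (p - 2 * k + 1 = p - k + 1 - k)%N by nia.
      have [hodd|hev] := boolP (odd k).
        have kE : k = (k./2).*2.+1 by have := odd_double_half k; lia.
        rewrite kE; apply: expn_le_mul_odd; first by lia.
        rewrite -kE; nia.
      have kE : k = (k./2).*2 by have := odd_double_half k; lia.
      rewrite kE; apply: expn_le_mul_even; first by lia.
      rewrite -kE; nia.
    rewrite -(@leq_pmul2r ((p - 2 * k + 1) ^ k)) ?expn_gt0 ?addn1 //.
    rewrite -addn1; apply: leq_trans h _.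
    by rewrite [leqRHS]mulnAC mulnC leq_mul2r hk orbT.
  have hq : ((p - k) ^ 2 <= (p - k.-1) * p.-1)%N.
    by rewrite expnS expn1; apply: leq_mul; lia.
  apply: leq_trans (leq_mul h hq) _.
  by rewrite mulnC mulnA.
have [h|[h|h]] : k = 2 \/ k = 3 \/ k = 4 by lia.
(* Shifting p by its least admissible value (5, 9 or 16) leaves a polynomial inequality in a natural
   number x. *)
- rewrite h in hp *; have [x ->] : exists x, p = (x + 5)%N by exists (p - 5)%N; lia.
  rewrite !ffactnS !ffactn0.
  have -> : (x + 5 - 2 = x + 3)%N by lia.
  have -> : (x + 5 - 2.-1 = x + 4)%N by lia.
  have -> : ((x + 5).-1 = x + 4)%N by lia.
  have -> : ((x + 3).-1 = x + 2)%N by lia.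
  nia.
- rewrite h in hp *; have [x ->] : exists x, p = (x + 9)%N by exists (p - 9)%N; lia.
  rewrite !ffactnS !ffactn0.
  have -> : (x + 9 - 3 = x + 6)%N by lia.
  have -> : (x + 9 - 3.-1 = x + 7)%N by lia.
  have -> : ((x + 9).-1 = x + 8)%N by lia.
  have -> : ((x + 8).-1 = x + 7)%N by lia.
  have -> : ((x + 6).-1 = x + 5)%N by lia.
  have -> : ((x + 5).-1 = x + 4)%N by lia.
  nia.
- rewrite h in hp *; have [x ->] : exists x, p = (x + 16)%N by exists (p - 16)%N; lia.
  rewrite !ffactnS !ffactn0.
  have -> : (x + 16 - 4 = x + 12)%N by lia.
  have -> : (x + 16 - 4.-1 = x + 13)%N by lia.
  have -> : ((x + 16).-1 = x + 15)%N by lia.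
  have -> : ((x + 15).-1 = x + 14)%N by lia.
  have -> : ((x + 14).-1 = x + 13)%N by lia.
  have -> : ((x + 12).-1 = x + 11)%N by lia.
  have -> : ((x + 11).-1 = x + 10)%N by lia.
  have -> : ((x + 10).-1 = x + 9)%N by lia.
  nia.
Qed.

(** The alternatives say that omega d^2, respectively nd - (p-1)c^2, is at most nd(omega-1)/omega;
    in the first a factor d is cancelled. *)
Lemma bin_ratio_dichotomy (p k : nat) : (2 <= k)%N -> (2 * k <= p)%N ->
  let t := (p %/ k)%N in
  (t ^ 2 * 'C(p - k, k) <= t.-1 * 'C(p, k))%N \/
  ('C(p, k) * 'C(p - k, k) <= t * p.-1 * 'C((p - k).-1, k.-1) ^ 2)%N.
Proof.
move=> k2 hp t.
have tk : (t * k <= p)%N by exact: leq_trunc_div.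
have pt : (p < t.+1 * k)%N by rewrite ltn_ceil //; lia.
have t2 : (2 <= t)%N by nia.
have [|notA] := leqP (t ^ 2 * 'C(p - k, k))%N (t.-1 * 'C(p, k))%N; [by left | right].
(* The relation (p-k)c = kd eliminates c from the second alternative. *)
suff main : ('C(p, k) * (p - k) ^ 2 <= t * p.-1 * k ^ 2 * 'C(p - k, k))%N.
  have hd : ((p - k) * 'C((p - k).-1, k.-1) = k * 'C(p - k, k))%N.
    by rewrite mul_bin_diag prednK //; lia.
  have pk : (0 < (p - k) ^ 2)%N by rewrite expn_gt0 subn_gt0; lia.
  rewrite -(leq_pmul2r pk).
  rewrite [leqRHS](_ : _ = t * p.-1 * ((p - k) * 'C((p - k).-1, k.-1)) ^ 2)%N; last by ring.
  rewrite hd.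
  rewrite [leqRHS](_ : _ = t * p.-1 * k ^ 2 * 'C(p - k, k) * 'C(p - k, k))%N; last by ring.
  by rewrite mulnAC leq_mul2r main orbT.
have [kt|tk'] := leqP k t.
  have p4 : (4 < p)%N.
    (* The case p = 4, k = 2 satisfies the first alternative: 4 <= 6. *)
    rewrite ltnNge; apply/negP => p4; have kE : k = 2 by lia.
    have pE : p = 4 by lia.
    by move: notA; rewrite /t kE pE.
  apply: leq_trans (bin_ratio_small_k k2 p4 _) _; first by nia.
  rewrite leq_mul2r; apply/orP; right.
  have : (p - k.-1 <= t * k)%N by nia.
  move=> h; rewrite [leqRHS](_ : _ = t * k * p.-1 * k)%N; last by ring.
  by rewrite !leq_mul2r h !orbT.
have t1 : (0 < t.-1)%N by lia.
have h := omega_lt_k_bound t2 tk' tk pt.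
rewrite -(leq_pmul2l t1) mulnA.
apply: leq_trans (_ : t ^ 2 * 'C(p - k, k) * (p - k) ^ 2 <= _)%N.
  by rewrite leq_mul2r (ltnW notA) orbT.
rewrite [leqLHS](_ : _ = t * 'C(p - k, k) * (t * (p - k) ^ 2))%N; last by ring.
rewrite [leqRHS](_ : _ = t * 'C(p - k, k) * (t.-1 * k ^ 2 * p.-1))%N; last by ring.
by rewrite leq_mul2l h orbT.
Qed.

(** * Multiplicities and traces *)

Local Open Scope ring_scope.

(** Sylvester's determinant identity: the block matrix N is made block triangular once from the
    right and once from the left. *)
Lemma det_sub_mulmxC (S : comNzRingType) (n r : nat) (y : S)
    (C : 'M[S]_(n, r)) (D : 'M[S]_(r, n)) :
  y ^+ r * \det (y%:M - C *m D) = y ^+ n * \det (y%:M - D *m C).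
Proof.
pose N := block_mx (y%:M : 'M_n) C D (1%:M : 'M_r).
have E1 : \det N = \det (y%:M - C *m D).
  have := congr1 determinant (mulmx_block (y%:M : 'M_n) C D (1%:M : 'M_r)
                 1%:M 0 (- D) 1%:M).
  rewrite det_mulmx det_lblock !det1 !mulr1 => ->.
  by rewrite !mulmx0 !mulmx1 mulmxN add0r mul1mx subrr !add0r det_ublock det1 mulr1.
rewrite -E1.
have := congr1 determinant (mulmx_block (1%:M : 'M_n) 0 (- D) (y%:M : 'M_r) y%:M C D 1%:M).
rewrite det_mulmx det_lblock !det1 mul1r det_scalar => ->.
rewrite !mul1mx !mul0mx !addr0 mulNmx mul_mx_scalar mul_scalar_mx addNr.
by rewrite det_ublock det_scalar mulmx1 mulNmx addrC.
Qed.

(* Apply the previous identity to a rank factorization of [A - a]. *)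
Lemma dvdp_char_poly_rank (F : fieldType) (n : nat) (A : 'M[F]_n) (a : F) :
  ('X - a%:P) ^+ (n - \rank (A - a%:M)) %| char_poly A.
Proof.
set B := A - a%:M; set r := \rank B; pose y : {poly F} := 'X - a%:P.
have hr : (r <= n)%N by exact: rank_leq_row.
have y0 : y ^+ r != 0 by rewrite expf_neq0 // polyXsubC_eq0.
have := @det_sub_mulmxC _ n r y (map_mx polyC (col_base B)) (map_mx polyC (row_base B)).
rewrite -map_mxM mulmx_base.
have -> : y%:M - map_mx polyC B = char_poly_mx A.
  by rewrite /B map_mxB map_scalar_mx /char_poly_mx /y raddfB /= opprB addrA subrK.
have -> : y ^+ n = y ^+ r * y ^+ (n - r) by rewrite -exprD subnKC.
rewrite -mulrA => /(mulfI y0); rewrite /char_poly => ->.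
exact: dvdp_mulr.
Qed.

(** Geometric multiplicity is at most algebraic multiplicity. *)
Lemma leq_rank_count_roots (F : fieldType) (n : nat) (A : 'M[F]_n)
    (mu : 'I_n -> F) (a : F) :
  char_poly A = \prod_i ('X - (mu i)%:P) ->
  (n - \rank ((A - a%:M)%R) <= #|[set i | mu i == a]|)%N.
Proof.
move=> hA.
have := dvdp_char_poly_rank A a.
rewrite -mup_geq ?monic_neq0 ?char_poly_monic // hA.
rewrite -(big_map mu xpredT (fun x => 'X - x%:P)) mu_prod_XsubC.
rewrite count_map cardE /enum_mem size_filter.
rewrite -enumT /= => /leq_trans; apply.
by rewrite /index_enum -enumT; apply: eq_leq; apply: eq_count => i; rewrite !inE.
Qed.

Lemma char_poly_comp (R : comNzRingType) (n : nat) (A : 'M[R]_n) (q : {poly R}) :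
  char_poly A \Po q = \det (q%:M - map_mx polyC A).
Proof.
rewrite /char_poly -[LHS](det_map_mx (comp_poly q)); congr (\det _).
rewrite /char_poly_mx map_mxB map_scalar_mx /= comp_polyX; congr (_ - _).
by apply/matrixP => i j; rewrite !mxE comp_polyC.
Qed.

(* [char_poly (A ^ 2)] is recovered from [det (X^2 - A^2) = det (X - A) * det (X + A)]. *)
Lemma char_poly_sqr (F : fieldType) (n : nat) (A : 'M[F]_n) (mu : 'I_n -> F) :
  char_poly A = \prod_i ('X - (mu i)%:P) ->
  char_poly (A *m A) = \prod_i ('X - (mu i ^+ 2)%:P).
Proof.
move=> hA; apply/eqP; rewrite -subr_eq0.
(* Substituting X^2 for X is injective on polynomials. *)
rewrite -(@comp_poly_eq0 _ _ ('X^2)) ?size_polyXn // rmorphB /= subr_eq0; apply/eqP.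
rewrite char_poly_comp rmorph_prod /=.
have h2 : \det ((- 'X)%:M - map_mx polyC A) = \prod_i (- 'X - (mu i)%:P).
  rewrite -char_poly_comp hA rmorph_prod; apply: eq_bigr => i _.
  by rewrite rmorphB /= comp_polyX comp_polyC.
have -> : ('X^2)%:M - map_mx polyC (A *m A) =
    - (char_poly_mx A *m ((- 'X)%:M - map_mx polyC A)).
  rewrite /char_poly_mx mulmxBl !mulmxBr -!scalar_mxM -map_mxM.
  rewrite mul_scalar_mx mul_mx_scalar scaleNr mulrN expr2 raddfN /=.
  by rewrite !opprD !opprK addrA addrK.
(* The sign (-1)^n is spread over the n factors, since X^2 - mu^2 = -(X - mu)(-X - mu). *)
rewrite -mulNmx det_mulmx h2 -scaleN1r detZ -/(char_poly A) hA.
rewrite -[X in _ ^+ X]card_ord -prodr_const -!big_split /=; apply: eq_bigr => i _.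
by rewrite rmorphB /= comp_polyX comp_polyC polyC_exp; ring.
Qed.

(** Both sides are minus the coefficient of degree n-1 of the characteristic polynomial of A^2. *)
Lemma mxtrace_sqr (F : fieldType) (n : nat) (A : 'M[F]_n) (mu : 'I_n -> F) :
  char_poly A = \prod_i ('X - (mu i)%:P) -> \tr (A *m A) = \sum_i mu i ^+ 2.
Proof.
case: n A mu => [|n] A mu hA; first by rewrite /mxtrace !big_ord0.
have h := char_poly_sqr hA.
have := char_poly_trace (A *m A) (ltn0Sn n); rewrite h.
rewrite -(big_map (fun i => mu i ^+ 2) xpredT (fun x => 'X - x%:P)).
set s := map _ _.
have hs : size s = n.+1 by rewrite size_map /index_enum -enumT size_enum_ord.
rewrite -{1}hs coefPn_prod_XsubC ?hs // => /oppr_inj <-.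
by rewrite big_map.
Qed.

(* Evaluate the eigenvalue equation at a coordinate of maximal absolute value. *)
Lemma eigenvalue_le_colsum (R : realFieldType) (n : nat) (A : 'M[R]_n) (a d : R) :
  (forall j, \sum_i `|A i j| <= d) -> eigenvalue A a -> `|a| <= d.
Proof.
move=> hd /eigenvalueP [v hv v0].
have [j0 hj0] : exists j0, v 0 j0 != 0.
  apply/existsP; apply: contraNT v0 => /existsPn h.
  by apply/eqP/rowP => j; rewrite mxE; apply/eqP; rewrite -[_ == _]negbK h.
pose j := [arg max_(j > j0) `|v 0 j|]%O.
have hj i : `|v 0 i| <= `|v 0 j|.
  by rewrite /j; case: arg_maxP => // m _ h; exact: h.
have vj : 0 < `|v 0 j| by apply: lt_le_trans (hj j0); rewrite normr_gt0.
rewrite -(ler_pM2r vj) -normrM.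
have -> : a * v 0 j = \sum_i v 0 i * A i j by move/rowP/(_ j): hv; rewrite !mxE => ->.
apply: le_trans (ler_norm_sum _ _ _) _.
apply: le_trans (ler_wpM2r (ltW vj) (hd j)).
rewrite mulr_suml; apply: ler_sum => i _.
by rewrite normrM mulrC ler_wpM2l.
Qed.

(** * Counting in the Kneser graph *)

Lemma ex_subset_card (T : finType) (B : {set T}) (k : nat) :
  (k <= #|B|)%N -> exists2 S : {set T}, S \subset B & #|S| = k.
Proof.
rewrite -bin_gt0 -cards_draws => /card_gt0P [S].
by rewrite inE => /andP [h /eqP h2]; exists S.
Qed.

Lemma big_kvert (R : Type) (idx : R) (op : Monoid.com_law idx) (p k : nat)
    (f : {set 'I_p} -> R) :
  \big[op/idx]_(i < knum p k) f (val (enum_val i))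
    = \big[op/idx]_(S : {set 'I_p} | #|S| == k) f S.
Proof.
rewrite -(@big_enum_val _ _ _ _ [pred _ : kvert p k | true] (fun u => f (val u))).
exact: esym (big_sub [pred S : {set 'I_p} | #|S| == k] f).
Qed.

Lemma card_disjoint_draws (p k : nat) (T : {set 'I_p}) :
  #|T| = k -> #|[set S : {set 'I_p} | (#|S| == k) && [disjoint S & T]]| = 'C(p - k, k).
Proof.
move=> hT.
have <- : #|~: T| = (p - k)%N by rewrite cardsCs setCK card_ord hT.
rewrite -cards_draws; apply: eq_card => S.
by rewrite !inE andbC subsets_disjoint setCK.
Qed.

(** If a is outside T, subtract from the k-subsets of the complement of T those avoiding a; Pascal's
    rule gives the difference. *)
Lemma card_disjoint_draws_mem (p k : nat) (T : {set 'I_p}) (a : 'I_p) :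
  (0 < k)%N -> #|T| = k ->
  #|[set S : {set 'I_p} | (#|S| == k) && (a \in S) && [disjoint S & T]]|
    = ((a \notin T) * 'C((p - k).-1, k.-1))%N.
Proof.
move=> k0 hT; case: (boolP (a \in T)) => aT.
  apply/eqP; rewrite cards_eq0; apply/eqP/setP => S; rewrite !inE.
  apply/negbTE/negP => /andP [/andP [_ aS]] /disjointFr /(_ aS).
  by rewrite aT.
rewrite mul1n; case: k k0 hT => // k _ hT /=.
have hC : #|~: T| = (p - k.+1)%N by rewrite cardsCs setCK card_ord hT.
have aC : a \in ~: T by rewrite inE.
have hC' : #|~: T :\ a| = (p - k.+1).-1 by rewrite -hC (cardsD1 a (~: T)) aC.
have pos : (0 < p - k.+1)%N by rewrite -hC; apply/card_gt0P; exists a.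
have := cardsID [set S : {set 'I_p} | a \in S]
  [set S : {set 'I_p} | (S \subset ~: T) & (#|S| == k.+1)].
rewrite cards_draws hC -(prednK pos) binS.
have -> : [set S : {set 'I_p} | S \subset ~: T & #|S| == k.+1] :\: [set S : {set 'I_p} | a \in S]
   = [set S : {set 'I_p} | S \subset ~: T :\ a & #|S| == k.+1].
  by apply/setP => S; rewrite !inE subsetD1; case: (_ \subset _); case: (a \in S).
rewrite cards_draws hC' addnC => /addnI <-.
apply: eq_card => S; rewrite !inE subsets_disjoint setCK.
by case: (a \in S); case: (#|S| == _); case: [disjoint _ & _].
Qed.

Lemma knumE (p k : nat) : knum p k = 'C(p, k).
Proof.
by rewrite /knum card_sig -[in RHS](card_ord p) -card_draws; apply: eq_card => S; rewrite !inE.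
Qed.

(** Exchanging a for b in a k-set that contains only a shows c(a) = c(b). Hence c is constant, and k
    c(a) = 0. *)
Lemma draw_sums_eq0 (R : numFieldType) (p k : nat) (c : 'I_p -> R) :
  (0 < k < p)%N ->
  (forall S : {set 'I_p}, #|S| = k -> \sum_(a in S) c a = 0) ->
  forall a, c a = 0.
Proof.
move=> /andP [k0 kp] hc.
have cE a b : c a = c b.
  have [->//|ab] := eqVneq a b.
  have hab : #|[set a; b]| = 2 by rewrite cards2 ab.
  have [|U hU cU] := @ex_subset_card _ (~: [set a; b]) k.-1.
    by rewrite cardsCs setCK hab card_ord; lia.
  have aU : a \notin U.
    by apply/negP => /(subsetP hU); rewrite !inE eqxx.
  have bU : b \notin U.
    by apply/negP => /(subsetP hU); rewrite !inE eqxx orbT.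
  have ha := hc (a |: U); have hb := hc (b |: U).
  rewrite cardsU1 aU cU add1n prednK // big_setU1 //= in ha.
  rewrite cardsU1 bU cU add1n prednK // big_setU1 //= in hb.
  by apply: (@addIr _ (\sum_(i in U) c i)); rewrite ha // hb.
move=> a; have [|S _ hS] := @ex_subset_card _ [set: 'I_p] k.
  by rewrite cardsT card_ord ltnW.
have := hc S hS.
rewrite (eq_bigr (fun=> c a)) ?sumr_const ?hS => [/eqP|i _]; last exact: cE.
by rewrite mulrn_eq0 (gtn_eqF k0) => /eqP.
Qed.

(** Double counting: each point lies in at most one member of the clique. *)
Lemma kclique_card_le (p k : nat) (Q : {set kvert p k}) :
  kclique Q -> (#|Q| * k <= p)%N.
Proof.
move=> /forall_inP hQ.
rewrite -sum_nat_const.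
have -> : (\sum_(v in Q) k = \sum_(v in Q) \sum_(x : 'I_p) (x \in val v))%N.
  apply: eq_bigr => v _; rewrite -big_mkcond sum1_card.
  by case: v => S /= /eqP ->.
rewrite exchange_big /= -[leqRHS](card_ord p) -sum1_card leq_sum // => x _.
rewrite -big_mkcondr sum1_card; apply/card_le1_eqP => u v /andP [uQ xu] /andP [vQ xv].
apply/eqP; apply: contraTT xv => uv.
have /forall_inP/(_ v vQ) := hQ u uQ; rewrite eq_sym uv => /= h.
by rewrite (disjointFr h xu).
Qed.

(** A maximum clique Q covers at most k|Q| points; if k more were available, a further k-set would
    extend it. *)
Lemma kclique_numberE (p k : nat) : (0 < k)%N -> kclique_number p k = (p %/ k)%N.
Proof.
move=> k0; apply/eqP; rewrite eqn_leq; apply/andP; split.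
  by apply/bigmax_leqP => Q /kclique_card_le; rewrite leq_divRL.
have h0 : kclique (set0 : {set kvert p k}) by apply/forall_inP => u; rewrite inE.
rewrite /kclique_number (@bigop.bigmax_eq_arg _ set0 _ _ h0); case: arg_maxnP => // Q hQ hmax.
rewrite -ltnS ltn_divLR // ltnNge; apply/negP => hp.
pose W := \bigcup_(v in Q) val v.
have cW : (#|W| <= #|Q| * k)%N.
  apply: leq_trans (_ : \sum_(v in Q) #|val v| <= _)%N.
    rewrite /W; elim/big_rec2: _ => [|v n V _ h]; first by rewrite cards0.
    by rewrite cardsU; apply: leq_trans (leq_subr _ _) _; rewrite leq_add2l.
  by rewrite -sum_nat_const; apply: leq_sum => v _; rewrite (eqP (valP v)).
have [|S hS cS] := @ex_subset_card _ (~: W) k.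
  by rewrite cardsCs setCK card_ord; move: hp cW; rewrite mulSn; lia.
have pS : #|S| == k by apply/eqP.
pose s : kvert p k := exist _ S pS.
have dS v : v \in Q -> [disjoint S & val v].
  move=> vQ; rewrite disjoints_subset; apply: subset_trans hS _.
  by rewrite setCS bigcup_sup.
have sQ : s \notin Q.
  apply/negP => /dS /=; rewrite -setI_eq0 setIid => /eqP h.
  by move: k0; rewrite -cS h cards0.
suff /hmax : kclique (s |: Q) by rewrite /= cardsU1 sQ add1n ltnn.
apply/forall_inP => u hu; apply/forall_inP => v hv; apply/implyP => uv.
move: hu hv; rewrite !inE => /orP [/eqP hu|hu] /orP [/eqP hv|hv].
- by rewrite hu hv eqxx in uv.
- by rewrite hu /kadj dS.
- by rewrite hv /kadj disjoint_sym dS.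
by move/forall_inP/(_ u hu)/forall_inP/(_ v hv): hQ; rewrite uv.
Qed.

(** Adjacent ordered pairs are grouped by their underlying edge. As k > 0 excludes loops, each fibre
    has exactly two elements. *)
Lemma knedges_double_sum (p k : nat) : (0 < k)%N ->
  (2 * knedges p k)%N = (\sum_(u : kvert p k) \sum_(v : kvert p k) kadj u v)%N.
Proof.
move=> k0.
have irr (u : kvert p k) : ~~ kadj u u.
  rewrite /kadj -setI_eq0 setIid -cards_eq0; case: u => S /= /eqP ->.
  by rewrite -lt0n.
rewrite pair_big /= -big_mkcond /= mulnC -sum_nat_const.
rewrite (partition_big (fun x : kvert p k * kvert p k => [set x.1; x.2])
           (mem (kedges p k))) /=; last first.
  move=> [u v] /= h; rewrite inE; apply/existsP; exists u; apply/existsP; exists v.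
  by rewrite eqxx.
apply: eq_bigr => E; rewrite inE => /existsP [u /existsP [v /andP [/eqP -> uv]]].
have neq : u != v by apply: contraTneq uv => ->; exact: irr.
rewrite sum1_card -[LHS](_ : #|[set (u, v); (v, u)]| = 2); last first.
  by rewrite cards2 xpair_eqE (negbTE neq).
apply: eq_card => -[x y]; rewrite !inE /= !xpair_eqE.
apply/idP/idP.
  case/orP => /andP [/eqP -> /eqP ->]; rewrite unfold_in /=; first by rewrite uv eqxx.
  by rewrite setUC eqxx andbT /kadj disjoint_sym.
rewrite unfold_in => /andP [/= xy /eqP hE].
have : x != y by apply: contraTneq xy => ->; exact: irr.
have : x \in [set u; v] by rewrite -hE !inE eqxx.
have : y \in [set u; v] by rewrite -hE !inE eqxx orbT.
rewrite !inE => /orP [] /eqP -> /orP [] /eqP ->; rewrite ?eqxx ?orbT //.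
Qed.

(** * Eigenvalues of the Kneser graph *)

Lemma card_kvert_set (p k : nat) (u : kvert p k) : #|val u| = k.
Proof. exact: eqP (valP u). Qed.

Lemma sum_kadjmx_col (R : nzRingType) (p k : nat) (j : 'I_(knum p k)) :
  \sum_i kadjmx R p k i j = 'C(p - k, k)%:R.
Proof.
pose T := val (enum_val j).
under eq_bigr do rewrite mxE.
rewrite (@big_kvert _ _ _ p k (fun S => [disjoint S & T]%:R)).
rewrite -(card_disjoint_draws (card_kvert_set (enum_val j))) -sum1_card natr_sum.
rewrite big_mkcond [RHS]big_mkcond /=.
by apply: eq_bigr => S _; rewrite inE; case: (#|S| == k); case: [disjoint _ & _].
Qed.

Lemma mxtrace_kadjmx_sqr (R : nzRingType) (p k : nat) :
  \tr (kadjmx R p k *m kadjmx R p k) = ('C(p, k) * 'C(p - k, k))%:R.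
Proof.
rewrite -(knumE p k).
rewrite /mxtrace natrM -[in RHS](card_ord (knum p k)) -sumr_const mulr_suml.
apply: eq_bigr => j _; rewrite mul1r -(sum_kadjmx_col R j) !mxE; apply: eq_bigr => i _.
by rewrite !mxE /kadj disjoint_sym; case: [disjoint _ & _]; rewrite ?mulr1 ?mulr0.
Qed.

Lemma knedges_double (p k : nat) : (0 < k)%N ->
  (2 * knedges p k = 'C(p, k) * 'C(p - k, k))%N.
Proof.
move=> k0; rewrite knedges_double_sum // exchange_big /=.
under eq_bigr => v _.
  rewrite (_ : (\sum_u kadj u v)%N = 'C(p - k, k)).
    over.
  rewrite -(card_disjoint_draws (card_kvert_set v)) -sum1_card.
  rewrite -(big_sub [pred S : {set 'I_p} | #|S| == k] (fun S => [disjoint S & val v] : nat)).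
  rewrite big_mkcond [RHS]big_mkcond /=.
  by apply: eq_bigr => S _; rewrite !inE; case: (#|S| == k); case: [disjoint _ & _].
by rewrite sum_nat_const -(knumE p k).
Qed.

Definition incidence_mx (R : nzRingType) (p k : nat) : 'M[R]_(p, knum p k) :=
  \matrix_(a, j) (a \in val (enum_val j : kvert p k))%:R.

Lemma incidence_mx_free (R : realFieldType) (p k : nat) :
  (0 < k < p)%N -> row_free (incidence_mx R p k).
Proof.
move=> hk; apply: inj_row_free => v hv; apply/rowP => a; rewrite mxE.
apply: (draw_sums_eq0 hk) => S /eqP hS.
have := congr1 (fun w : 'rV_(knum p k) => w 0 (enum_rank (exist _ S hS : kvert p k))) hv.
rewrite !mxE => hsum; rewrite -[RHS]hsum big_mkcond; apply: eq_bigr => b _.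
by rewrite mxE enum_rankK /=; case: (b \in S); rewrite ?mulr1 ?mulr0.
Qed.

(** In row a and column T, the product with A is c when a is outside T and 0 otherwise; adding c
    times the incidence matrix supplies c exactly when a is in T. *)
Lemma incidence_mx_kadjmx (R : comNzRingType) (p k : nat) : (0 < k)%N ->
  incidence_mx R p k *m (kadjmx R p k + 'C((p - k).-1, k.-1)%:R%:M)
    = const_mx 'C((p - k).-1, k.-1)%:R.
Proof.
move=> k0; rewrite mulmxDr; apply/matrixP => a j; rewrite mul_mx_scalar !mxE.
pose T := val (enum_val j).
have -> : \sum_i incidence_mx R p k a i * kadjmx R p k i j
    = ((a \notin T) * 'C((p - k).-1, k.-1))%:R.
  under eq_bigr do rewrite !mxE.
  rewrite (@big_kvert _ _ _ p k (fun S => (a \in S)%:R * [disjoint S & T]%:R)).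
  rewrite -(card_disjoint_draws_mem a k0 (card_kvert_set (enum_val j))) -sum1_card natr_sum.
  rewrite big_mkcond [RHS]big_mkcond /=.
  apply: eq_bigr => S _; rewrite inE.
  by case: (#|S| == k); case: (a \in S); case: [disjoint _ & _]; rewrite ?mul0r ?mulr0 ?mulr1.
by rewrite /T; case: (a \in _); rewrite ?mul0n ?mul1n ?mulr1 ?mulr0 ?addr0 ?add0r.
Qed.

(* [A + c] maps the row space of the incidence matrix, of dimension [p], into
   a line. *)
Lemma leq_corank_kadjmx (R : realFieldType) (p k : nat) : (0 < k < p)%N ->
  (p.-1 <= knum p k - \rank (kadjmx R p k - (- 'C((p - k).-1, k.-1)%:R)%:M)%R)%N.
Proof.
move=> hk; have /andP [k0 _] := hk; rewrite raddfN opprK.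
have := mxrank_mul_ker (incidence_mx R p k) (kadjmx R p k + 'C((p - k).-1, k.-1)%:R%:M).
rewrite incidence_mx_kadjmx // (eqP (incidence_mx_free R hk)).
set B := kadjmx _ _ _ + _; set c := 'C(_, _)%:R.
have h1 : (\rank (const_mx c : 'M[R]_(p, knum p k)) <= 1)%N.
  have -> : (const_mx c : 'M[R]_(p, knum p k))
      = (const_mx c : 'M_(p, 1)) *m (const_mx 1 : 'M_(1, knum p k)).
    by apply/matrixP => a j; rewrite !mxE big_ord1 !mxE mulr1.
  exact: leq_trans (mxrankM_maxl _ _) (rank_leq_col _).
have h2 : (\rank (incidence_mx R p k :&: kermx B)%MS <= knum p k - \rank B)%N.
  by rewrite -mxrank_ker; apply: mxrankS; exact: capmxSr.
move=> h; rewrite -subn1 leq_subLR.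
by apply: leq_trans (leq_add h1 h2); rewrite h.
Qed.

(** If mu(i) were not positive, all positive values would have index below i, so there would be at
    most i of them. *)
Lemma sorted_lt_card_pos (R : numDomainType) (n : nat) (mu : 'I_n -> R) (i : 'I_n) :
  (forall i j : 'I_n, (i <= j)%N -> mu j <= mu i) ->
  (i < #|[set i | (0 < mu i)%R]|)%N -> 0 < mu i.
Proof.
move=> hmu; apply: contraTT => hi; rewrite -leqNgt.
have hsub : [set j | 0 < mu j] \subset [set j : 'I_n | (j < i)%N].
  apply/subsetP => j; rewrite !inE ltnNge; apply: contraL => hij.
  by apply: contra hi => hj; apply: lt_le_trans hj (hmu _ _ hij).
apply: leq_trans (subset_leq_card hsub) _.
rewrite -sum1_card (eq_bigl (fun j : 'I_n => (j < i)%N)); last by move=> j; rewrite inE.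
by rewrite -(big_ord_widen n (fun=> 1%N) (ltnW (ltn_ord i))) sum1_card card_ord.
Qed.

Theorem mainTheorem2 (R : realType) (p k : nat) (mu : 'I_(knum p k) -> R) :
  (2 <= k)%N -> (2 * k <= p)%N ->
  (* mu_1 >= ... >= mu_n are the eigenvalues (with multiplicity) of A *)
  (forall i j : 'I_(knum p k), (i <= j)%N -> mu j <= mu i) ->
  char_poly (kadjmx R p k) = \prod_(i < knum p k) ('X - (mu i)%:P) ->
  let npos := #|[set i | 0 < mu i]| in
  let omega := kclique_number p k in
  let l := minn npos omega in
  \sum_(i < knum p k | (i < l)%N) mu i ^+ 2
    <= (2 * knedges p k)%:R * (omega%:R - 1) / omega%:R.
Proof.
move=> k2 hp hmu hA; cbv zeta.
set npos := #|[set i | 0 < mu i]|; set omega := kclique_number p k; set l := minn npos omega.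
have k0 : (0 < k)%N by lia.
have hw : omega = (p %/ k)%N by exact: kclique_numberE.
have w2 : (2 <= omega)%N by rewrite hw leq_divRL.
have [w hw1] : exists w, omega = w.+1 by exists omega.-1; lia.
have ew : omega%:R - 1 = w%:R :> R by rewrite hw1 -natr1 addrK.
rewrite ew hw1 knedges_double //.
set d := 'C(p - k, k); set n := 'C(p, k).
rewrite ler_pdivlMr ?ltr0n //.
case: (bin_ratio_dichotomy k2 hp); rewrite -hw hw1 /= -/d -/n.
- move=> h.
  have hmu2 i : mu i ^+ 2 <= d%:R ^+ 2.
    rewrite -real_normK ?num_real // lerXn2r ?nnegrE ?ler0n //.
    apply: (@eigenvalue_le_colsum _ _ (kadjmx R p k)).
      move=> j; rewrite -/d -(sum_kadjmx_col R j); apply: ler_sum => a _.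
      by rewrite mxE ger0_norm ?ler0n.
    by rewrite eigenvalue_root_char hA rootE horner_prod (bigD1 i) //= hornerXsubC subrr mul0r.
  have hsum : \sum_(i < knum p k | (i < l)%N) mu i ^+ 2 <= w.+1%:R * d%:R ^+ 2.
    apply: le_trans (ler_sum _ (fun i _ => hmu2 i)) _.
    rewrite sumr_const -[leLHS]mulr_natl ler_wpM2r ?sqr_ge0 // ler_nat.
    apply: leq_trans (_ : l <= _)%N; last by rewrite -hw1 geq_minr.
    (* It remains to count the indices below l; [big_ord_widen] does so when l <= n. *)
    have [hl|hl] := leqP l (knum p k).
      by rewrite -sum1_card -(big_ord_widen _ (fun=> 1%N) hl) sum1_card card_ord.
    by apply: leq_trans (max_card _) _; rewrite card_ord ltnW.
  apply: le_trans (ler_wpM2r (ler0n _ _) hsum) _.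
  rewrite -!natrX -!natrM ler_nat.
  rewrite [leqLHS](_ : _ = d * (w.+1 ^ 2 * d))%N; last by ring.
  by rewrite [leqRHS](_ : _ = d * (w * n))%N ?leq_mul2l ?h ?orbT //; ring.
- set l1 := 'C(_, _) => h.
  have htr : \sum_i mu i ^+ 2 = (n * d)%:R.
    by rewrite -(mxtrace_sqr hA) mxtrace_kadjmx_sqr.
  have hneg : (p.-1 <= #|[set i | mu i == - l1%:R]|)%N.
    apply: leq_trans (leq_rank_count_roots _ hA); apply: leq_corank_kadjmx; lia.
  (* The indices below l carry positive eigenvalues, so they are disjoint from the at least p-1
     indices carrying -c. *)
  have hsum : \sum_(i < knum p k | (i < l)%N) mu i ^+ 2 + p.-1%:R * l1%:R ^+ 2 <= (n * d)%:R.
    rewrite -htr [leRHS](bigID (fun i : 'I__ => (i < l)%N)) /= lerD2l.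
    apply: le_trans (_ : \sum_(i in [set i | mu i == - l1%:R]) mu i ^+ 2 <= _).
      rewrite (eq_bigr (fun=> l1%:R ^+ 2)); last first.
        by move=> i; rewrite inE => /eqP ->; rewrite sqrrN.
      by rewrite sumr_const -[leRHS]mulr_natl ler_wpM2r ?sqr_ge0 // ler_nat.
    rewrite big_mkcond [leRHS]big_mkcond; apply: ler_sum => i _; rewrite inE.
    case: eqP => [hi|_]; last by case: ifP; rewrite ?sqr_ge0.
    case: ltnP => //= hil; exfalso.
    have : 0 < mu i by apply: sorted_lt_card_pos hmu _; apply: leq_trans hil (geq_minl _ _).
    by rewrite hi oppr_gt0 ltNge ler0n.
  have h' : (n * d)%:R <= w.+1%:R * (p.-1%:R * l1%:R ^+ 2) :> R.
    by rewrite -natrX -!natrM ler_nat mulnA.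
  rewrite natrM in hsum h' *; move: hsum h'; rewrite -!natr1.
  set s := \sum_(_ < _ | _) _; set q := _ * l1%:R ^+ 2 => hsum h'.
  rewrite -natrM in hsum h' *.
  have hw0 : 0 <= (w%:R : R) + 1 by rewrite natr1 ler0n.
  (* From (w+1)(s+q) <= (w+1)nd subtract nd <= (w+1)q. *)
  have := ler_wpM2r hw0 hsum; lra.
Qed.
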